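(* Let $A$ and $B$ be finite nonempty sets and let $g : A\times B\to \mathbf{No}$, $(a,b)\mapsto g(a,b)$, be a payoff function with values in the surreal numbers $\mathbf{No}$. If the payoff function $g$ is coherent, then there exist non-negative surreal numbers $p_a$, $a\in A$, such that $\sum_{a\in A}p_a=1$ and $$\sum_{a\in A}p_a\cdot g(a,b)\geq 0\quad\text{for all } b\in B.$$
   Context: $\mathbf{No}$ denotes Conway's ordered field (a proper class) of surreal numbers, with its usual addition, multiplication and total order. Setup: $A$ is the set of outcomes of a random event and $B$ is a set of bookmakers; bookmaker $b$ offers Alice the payoff $g(a,b)$ (positive or negative) if the outcome is $a$. A portfolio is a surreal-valued probability vector $Q=(q_b)_{b\in B}$ on $B$, i.e. $q_b\in\mathbf{No}$, $q_b\ge 0$ and $\sum_{b\in B}q_b=1$. Its payoff function is $a\mapsto\sum_{b\in B}q_b\cdot g(a,b)$. A Dutch book is a portfolio whose payoff function is strictly negative for every outcome, i.e. $\sum_{b\in B}q_b\cdot g(a,b)<0$ for all $a\in A$. The payoff function $g$ is called coherent if no Dutch book exists. *)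

(* Defs.v *)
From mathcomp Require Import all_boot.

Set Implicit Arguments.
Unset Strict Implicit.
Unset Printing Implicit Defensive.

(** Conway's construction of the surreal numbers.  A game [{L | R}] is given by
    two families of previously constructed games.  The index types range over a
    fixed universe, whose types play the role of sets; [game], like [surreal]
    below, lives one universe higher, as a proper class does. *)
Inductive game : Type :=
  Game (L R : Type) (xL : L -> game) (xR : R -> game).

Definition lidx (x : game) : Type := let: Game L _ _ _ := x in L.
Definition ridx (x : game) : Type := let: Game _ R _ _ := x in R.
Definition lopt (x : game) : lidx x -> game :=
  let: Game _ _ xL _ := x in xL.
Definition ropt (x : game) : ridx x -> game :=
  let: Game _ _ _ xR := x in xR.

(** [gcmp x y] is the pair of propositions [(x <= y, y <= x)]; computing both
    at once makes Conway's mutually swapped recursion structural.  Lemma [gleE]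
    below is Conway's defining clause. *)
Fixpoint gcmp (x : game) : game -> Prop * Prop :=
  match x with
  | Game _ _ xL xR =>
    fix gcmp_x (y : game) : Prop * Prop :=
      match y with
      | Game _ _ yL yR =>
        ((forall i, ~ (gcmp (xL i) y).2) /\ (forall j, ~ (gcmp_x (yR j)).2),
         (forall i, ~ (gcmp_x (yL i)).1) /\ (forall j, ~ (gcmp (xR j) y).1))
      end
  end.

Definition gle (x y : game) : Prop := (gcmp x y).1.
Definition glt (x y : game) : Prop := gle x y /\ ~ gle y x.

(** Equality of surreal numbers, as opposed to identity of their forms. *)
Definition geqv (x y : game) : Prop := gle x y /\ gle y x.

Lemma gcmp_swap (x y : game) :
  ((gcmp x y).1 <-> (gcmp y x).2) /\ ((gcmp x y).2 <-> (gcmp y x).1).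
Proof.
elim: x y => XL XR xL IHL xR IHR; elim=> YL YR yL JHL yR JHR.
set x := Game xL xR; set y := Game yL yR.
split; split=> -[H1 H2]; split=> k Hk.
- exact: (H1 k (proj2 (proj2 (IHL k y)) Hk)).
- exact: (H2 k (proj2 (proj2 (JHR k)) Hk)).
- exact: (H1 k (proj1 (proj2 (IHL k y)) Hk)).
- exact: (H2 k (proj1 (proj2 (JHR k)) Hk)).
- exact: (H1 k (proj2 (proj1 (JHL k)) Hk)).
- exact: (H2 k (proj2 (proj1 (IHR k y)) Hk)).
- exact: (H1 k (proj1 (proj1 (JHL k)) Hk)).
- exact: (H2 k (proj1 (proj1 (IHR k y)) Hk)).
Qed.

Lemma gleE (x y : game) :
  gle x y <-> (forall i : lidx x, ~ gle y (lopt i)) /\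
              (forall j : ridx y, ~ gle (ropt j) x).
Proof.
rewrite /gle; case: x => XL XR xL xR; case: y => YL YR yL yR.
set x := Game xL xR; set y := Game yL yR.
split=> -[H1 H2]; split=> k Hk.
- exact: (H1 k (proj1 (proj1 (gcmp_swap y (xL k))) Hk)).
- exact: (H2 k (proj1 (proj1 (gcmp_swap (yR k) x)) Hk)).
- exact: (H1 k (proj2 (proj1 (gcmp_swap y (xL k))) Hk)).
- exact: (H2 k (proj2 (proj1 (gcmp_swap (yR k) x)) Hk)).
Qed.

Definition gzero : game :=
  @Game Empty_set Empty_set (Empty_set_rect _) (Empty_set_rect _).
Definition gone : game :=
  @Game unit Empty_set (fun=> gzero) (Empty_set_rect _).

Fixpoint gopp (x : game) : game :=
  match x with
  | Game _ _ xL xR => Game (fun j => gopp (xR j)) (fun i => gopp (xL i))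
  end.

Fixpoint gadd (x : game) : game -> game :=
  match x with
  | Game XL XR xL xR =>
    fix gadd_x (y : game) : game :=
      match y with
      | Game YL YR yL yR =>
        Game (fun k : (XL + YL)%type =>
                match k with
                | inl i => gadd (xL i) y
                | inr i => gadd_x (yL i)
                end)
             (fun k : (XR + YR)%type =>
                match k with
                | inl j => gadd (xR j) y
                | inr j => gadd_x (yR j)
                end)
      end
  end.

Definition gsub (x y : game) : game := gadd x (gopp y).

Fixpoint gmul (x : game) : game -> game :=
  match x with
  | Game XL XR xL xR =>
    fix gmul_x (y : game) : game :=
      match y with
      | Game YL YR yL yR =>
        Game
          (fun k : (XL * YL + XR * YR)%type =>
             match k with
             | inl (i, j) =>
                 gsub (gadd (gmul (xL i) y) (gmul_x (yL j))) (gmul (xL i) (yL j))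
             | inr (i, j) =>
                 gsub (gadd (gmul (xR i) y) (gmul_x (yR j))) (gmul (xR i) (yR j))
             end)
          (fun k : (XL * YR + XR * YL)%type =>
             match k with
             | inl (i, j) =>
                 gsub (gadd (gmul (xL i) y) (gmul_x (yR j))) (gmul (xL i) (yR j))
             | inr (i, j) =>
                 gsub (gadd (gmul (xR i) y) (gmul_x (yL j))) (gmul (xR i) (yL j))
             end)
      end
  end.

Fixpoint numeric (x : game) : Prop :=
  match x with
  | Game _ _ xL xR =>
    [/\ forall i j, ~ gle (xR j) (xL i),
        forall i, numeric (xL i) & forall j, numeric (xR j)]
  end.

(** The class No.  Its elements are forms of numbers, the equality of No being
    [geqv]; the order, sums and products of numbers are those of the underlying
    games, as in Conway's definition. *)
Record surreal : Type := Surreal { form :> game; formP : numeric form }.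

Declare Scope No_scope.
Delimit Scope No_scope with No.
Bind Scope No_scope with game surreal.

Notation "0" := gzero : No_scope.
Notation "1" := gone : No_scope.
Notation "x + y" := (gadd x y) : No_scope.
Notation "x * y" := (gmul x y) : No_scope.
Notation "x <= y" := (gle x y) : No_scope.
Notation "x < y" := (glt x y) : No_scope.
Notation "x === y" := (geqv x y) (at level 70, no associativity) : No_scope.
Notation "\sum_ ( i : t ) F" := (\big[gadd/gzero]_(i : t) F%No) : No_scope.

Definition prob_vector (T : finType) (q : T -> surreal) : Prop :=
  (forall t, 0 <= q t)%No /\ (\sum_(t : T) q t === 1)%No.

Section Bookmaking.
Variables (A B : finType) (g : A -> B -> surreal).

Definition payoff (q : B -> surreal) (a : A) : game :=
  (\sum_(b : B) (q b * g a b))%No.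

Definition dutch_book (q : B -> surreal) : Prop :=
  prob_vector q /\ (forall a : A, payoff q a < 0)%No.

Definition coherent : Prop := ~ exists q : B -> surreal, dutch_book q.

End Bookmaking.

(* Main.v *)
Require Import Defs.
From HB Require Import structures.
From mathcomp Require Import all_boot all_order all_algebra.
From mathcomp Require Import boolp ring lra.

(** The surreal numbers form an ordered field, and over any ordered field the
    statement is the theorem of the alternative for finite systems of linear
    inequalities: either a mixture of the columns of [g] is negative in every
    row, or a mixture of its rows is nonnegative in every column.  A coherent
    [g] excludes the first case.

    That alternative ([alternative]) is proved by Fourier-Motzkin elimination,
    by induction on the set of columns ([alternative_seq]).  To eliminate a
    column [c], one replaces the rows by nonnegative combinations of them in
    which [c] has become nonnegative: the rows [i] with [c i >= 0], and
    [c i * row j - c j * row i] for [c i >= 0 > c j].  Weights of the new rows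
    yield weights of the old ones, and a solution in the remaining columns
    extends because the conditions on the new variable [t] are finitely many
    bounds, each lower bound being less than each upper bound
    ([elimination_solvable]).

    Most of the work is the ordered field.  Games modulo equality form an
    abelian group with a translation invariant order ([gclass]), and the
    product of games satisfies the ring identities in it, each by an induction
    that compares options ([cls_opt]).  For arbitrary games the product does not
    respect equality; for numbers it does.  This is proved together with the
    facts that products of numbers are numbers and that
    [(x2 - x1) * (y - y')] has the expected sign for [x1 < x2] and an option
    [y'] of [y] ([numeric_mul_mono]).  The numbers then form a subgroup [No] of
    [gclass] which is an ordered integral domain, and Conway's recursive
    construction of [1 / x] ([inv_gameE]) makes it a field. *)

Set Implicit Arguments.
Unset Strict Implicit.
Unset Printing Implicit Defensive.

Import Order.TTheory GRing.Theory Num.Theory.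

(** * Options *)

(** [false] is the left side and [true] the right side, so that the side of an
    option of a product is the exclusive or of the sides of the options of the
    factors; most case distinctions of the theory then disappear. *)
Definition option_of (s : bool) (x o : game) : Prop :=
  if s then exists j, ropt (x := x) j = o else exists i, lopt (x := x) i = o.

Lemma game_opt_ind (P : game -> Prop) :
  (forall x, (forall s x', option_of s x x' -> P x') -> P x) -> forall x, P x.
Proof.
move=> IH; elim=> L R xL IHL xR IHR; apply: IH.
by case=> x' [i <-]; [apply: IHR | apply: IHL].
Qed.

Lemma gle_optE x y : gle x y <->
  (forall x', option_of false x x' -> ~ gle y x') /\
  (forall y', option_of true y y' -> ~ gle y' x).
Proof.
rewrite gleE; split=> -[hl hr]; split.
- by move=> _ [i <-]; apply: hl.
- by move=> _ [j <-]; apply: hr.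
- by move=> i; apply: hl; exists i.
- by move=> j; apply: hr; exists j.
Qed.

Lemma gle_intro x y : (forall x', option_of false x x' -> ~ gle y x') ->
  (forall y', option_of true y y' -> ~ gle y' x) -> gle x y.
Proof. by move=> hl hr; apply/gle_optE. Qed.

Lemma gle_lopt x y x' : gle x y -> option_of false x x' -> ~ gle y x'.
Proof. by move=> /gle_optE[+ _]; apply. Qed.

Lemma gle_ropt x y y' : gle x y -> option_of true y y' -> ~ gle y' x.
Proof. by move=> /gle_optE[_]; apply. Qed.

Lemma opt_opp s x o : option_of s (gopp x) o <->
  exists2 x', option_of (~~ s) x x' & o = gopp x'.
Proof.
case: x s => L R xL xR [] /=; split.
- by case=> i <-; exists (xL i) => //; exists i.
- by case=> _ [i <-] ->; exists i.
- by case=> i <-; exists (xR i) => //; exists i.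
- by case=> _ [i <-] ->; exists i.
Qed.

Lemma opt_add s x y o : option_of s (gadd x y) o <->
  (exists2 x', option_of s x x' & o = gadd x' y) \/
  (exists2 y', option_of s y y' & o = gadd x y').
Proof.
case: x y s => XL XR xL xR [YL YR yL yR] [] /=; split.
- case=> -[i|i] <-; [left; exists (xR i) | right; exists (yR i)] => //;
  by exists i.
- by case=> -[_ [i <-] ->]; [exists (inl i) | exists (inr i)].
- case=> -[i|i] <-; [left; exists (xL i) | right; exists (yL i)] => //;
  by exists i.
- by case=> -[_ [i <-] ->]; [exists (inl i) | exists (inr i)].
Qed.

Lemma opt_mul s x y o : option_of s (gmul x y) o <->
  exists t x' y', [/\ option_of t x x', option_of (s (+) t) y y' &
    o = gsub (gadd (gmul x' y) (gmul x y')) (gmul x' y')].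
Proof.
case: x y s => XL XR xL xR [YL YR yL yR] [] /=; split.
- case=> -[[i j]|[i j]] <-.
    by exists false, (xL i), (yR j); split=> //; [exists i | exists j].
  by exists true, (xR i), (yL j); split=> //; [exists i | exists j].
- case=> -[] [_ [_ [[i <-] [j <-] ->]]]; first by exists (inr (i, j)).
  by exists (inl (i, j)).
- case=> -[[i j]|[i j]] <-.
    by exists false, (xL i), (yL j); split=> //; [exists i | exists j].
  by exists true, (xR i), (yR j); split=> //; [exists i | exists j].
- case=> -[] [_ [_ [[i <-] [j <-] ->]]]; first by exists (inr (i, j)).
  by exists (inl (i, j)).
Qed.

Lemma opt_zero s o : ~ option_of s gzero o.
Proof. by case: s => -[[]]. Qed.

Lemma opt_one s o : option_of s gone o <-> ~~ s /\ o = gzero.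
Proof.
case: s; first by split=> [[[]]|[]].
by split=> [[i <-] //|[_ ->]]; exists tt.
Qed.

(** * Order and sums of games *)

Lemma gle_refl x : gle x x.
Proof.
elim/game_opt_ind: x => x IH; apply: gle_intro => x' ox' le_x.
  exact: (gle_lopt le_x ox' (IH _ _ ox')).
exact: (gle_ropt le_x ox' (IH _ _ ox')).
Qed.

(** The induction step passes from [(x, y, z)] to [(y, z, x')] and
    [(z', x, y)], which is why the three rotations are proved together. *)
Lemma gle_trans y x z : gle x y -> gle y z -> gle x z.
Proof.
pose T a b c := gle a b -> gle b c -> gle a c.
suff: [/\ T x y z, T y z x & T z x y] by case.
elim/game_opt_ind: x y z => x IHx; elim/game_opt_ind=> y IHy.
elim/game_opt_ind=> z IHz.
split=> hab hbc; apply: gle_intro => o oo le_o.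
- by have [_ + _] := IHx _ _ oo y z; move/(_ hbc le_o)/(gle_lopt hab oo).
- by have [_ _ +] := IHz _ _ oo; move/(_ le_o hab)/(gle_ropt hbc oo).
- by have [_ _ +] := IHy _ _ oo z; move/(_ hbc le_o)/(gle_lopt hab oo).
- by have [+ _ _] := IHx _ _ oo y z; move/(_ le_o hab)/(gle_ropt hbc oo).
- by have [+ _ _] := IHz _ _ oo; move/(_ hbc le_o)/(gle_lopt hab oo).
- by have [_ + _] := IHy _ _ oo z; move/(_ le_o hab)/(gle_ropt hbc oo).
Qed.

Lemma lopt_nge x x' : option_of false x x' -> ~ gle x x'.
Proof. exact/gle_lopt/gle_refl. Qed.

Lemma ropt_nle x x' : option_of true x x' -> ~ gle x' x.
Proof. exact/gle_ropt/gle_refl. Qed.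

Lemma geqv_refl x : geqv x x.
Proof. by split; apply: gle_refl. Qed.

Lemma geqv_sym x y : geqv x y -> geqv y x.
Proof. by case. Qed.

Lemma geqv_trans y x z : geqv x y -> geqv y z -> geqv x z.
Proof.
by move=> [xy yx] [yz zy]; split; [exact: gle_trans yz | exact: gle_trans yx].
Qed.

(** Games whose options agree up to equality are equal.  All the identities
    between sums and products of games follow from this by induction. *)
Lemma geqv_opt x y :
  (forall s x', option_of s x x' -> exists2 y', option_of s y y' & geqv x' y') ->
  (forall s y', option_of s y y' -> exists2 x', option_of s x x' & geqv x' y') ->
  geqv x y.
Proof.
move=> hx hy; split; apply: gle_intro => o oo le_o.
- by have [o' oo' [h _]] := hx _ _ oo; apply: (lopt_nge oo'); apply: gle_trans h.
- have [o' oo' [h _]] := hy _ _ oo; apply: (ropt_nle oo').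
  exact: gle_trans le_o.
- have [o' oo' [_ h]] := hy _ _ oo; apply: (lopt_nge oo').
  exact: gle_trans h.
- have [o' oo' [_ h]] := hx _ _ oo; apply: (ropt_nle oo').
  exact: gle_trans le_o.
Qed.

Lemma gaddC x y : geqv (gadd x y) (gadd y x).
Proof.
elim/game_opt_ind: x y => x IHx; elim/game_opt_ind=> y IHy.
apply: geqv_opt => s o /opt_add[[x' ox ->]|[y' oy ->]].
- by exists (gadd y x'); [apply/opt_add; right; exists x' | apply: IHx ox _].
- by exists (gadd y' x); [apply/opt_add; left; exists y' | apply: IHy oy].
- by exists (gadd x x'); [apply/opt_add; right; exists x' | apply: IHy ox].
- by exists (gadd y' y); [apply/opt_add; left; exists y' | apply: IHx oy _].
Qed.

Lemma gaddA x y z : geqv (gadd x (gadd y z)) (gadd (gadd x y) z).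
Proof.
elim/game_opt_ind: x y z => x IHx; elim/game_opt_ind=> y IHy.
elim/game_opt_ind=> z IHz.
apply: geqv_opt => s o /opt_add[[o1 oo1 ->]|[o1 oo1 ->]].
- exists (gadd (gadd o1 y) z); last exact: IHx oo1 _ _.
  by apply/opt_add; left; exists (gadd o1 y) => //; apply/opt_add; left; exists o1.
- case/opt_add: oo1 => -[o2 oo2 ->].
    exists (gadd (gadd x o2) z); last exact: IHy oo2 _.
    by apply/opt_add; left; exists (gadd x o2) => //; apply/opt_add; right; exists o2.
  exists (gadd (gadd x y) o2); last exact: IHz oo2.
  by apply/opt_add; right; exists o2.
- case/opt_add: oo1 => -[o2 oo2 ->].
    exists (gadd o2 (gadd y z)); last exact: IHx oo2 _ _.
    by apply/opt_add; left; exists o2.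
  exists (gadd x (gadd o2 z)); last exact: IHy oo2 _.
  by apply/opt_add; right; exists (gadd o2 z) => //; apply/opt_add; left; exists o2.
- exists (gadd x (gadd y o1)); last exact: IHz oo1.
  by apply/opt_add; right; exists (gadd y o1) => //; apply/opt_add; right; exists o1.
Qed.

Lemma gadd0 x : geqv (gadd gzero x) x.
Proof.
elim/game_opt_ind: x => x IH; apply: geqv_opt => s o.
  case/opt_add=> -[o' oo ->]; first by case: (opt_zero oo).
  by exists o' => //; apply: IH oo.
move=> oo; exists (gadd gzero o); last exact: IH oo.
by apply/opt_add; right; exists o.
Qed.

Lemma gle_opp x y : gle (gopp x) (gopp y) <-> gle y x.
Proof.
suff: (gle (gopp x) (gopp y) <-> gle y x) /\ (gle (gopp y) (gopp x) <-> gle x y).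
  by case.
elim/game_opt_ind: x y => x IHx; elim/game_opt_ind=> y IHy.
split; (split=> le; apply: gle_intro => o oo le_o).
- apply: (gle_ropt (y' := gopp o) le); last by apply: (IHy _ _ oo).2.2.
  by apply/opt_opp; exists o.
- apply: (gle_lopt (x' := gopp o) le); last by apply: (IHx _ _ oo y).2.2.
  by apply/opt_opp; exists o.
- case/opt_opp: oo le_o => o' oo -> /(IHx _ _ oo y).2.1; exact: gle_ropt oo.
- case/opt_opp: oo le_o => o' oo -> /(IHy _ _ oo).2.1; exact: gle_lopt oo.
- apply: (gle_ropt (y' := gopp o) le); last by apply: (IHx _ _ oo y).1.2.
  by apply/opt_opp; exists o.
- apply: (gle_lopt (x' := gopp o) le); last by apply: (IHy _ _ oo).1.2.
  by apply/opt_opp; exists o.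
- case/opt_opp: oo le_o => o' oo -> /(IHy _ _ oo).1.1; exact: gle_ropt oo.
- case/opt_opp: oo le_o => o' oo -> /(IHx _ _ oo y).1.1; exact: gle_lopt oo.
Qed.

Lemma gaddN x : geqv (gadd x (gopp x)) gzero.
Proof.
elim/game_opt_ind: x => x IH.
split; apply: gle_intro => o; try by move=> /opt_zero.
- case/opt_add=> -[o' oo ->] le_o.
    apply: (gle_ropt (y' := gadd o' (gopp o')) le_o); last exact: (IH _ _ oo).1.
    apply/opt_add; right; exists (gopp o') => //.
    by apply/opt_opp; exists o'.
  case/opt_opp: oo le_o => o2 oo -> le_o.
  apply: (gle_ropt (y' := gadd o2 (gopp o2)) le_o); last exact: (IH _ _ oo).1.
  by apply/opt_add; left; exists o2.
- case/opt_add=> -[o' oo ->] le_o.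
    apply: (gle_lopt (x' := gadd o' (gopp o')) le_o); last exact: (IH _ _ oo).2.
    apply/opt_add; right; exists (gopp o') => //.
    by apply/opt_opp; exists o'.
  case/opt_opp: oo le_o => o2 oo -> le_o.
  apply: (gle_lopt (x' := gadd o2 (gopp o2)) le_o); last exact: (IH _ _ oo).2.
  by apply/opt_add; left; exists o2.
Qed.

(** Monotonicity and cancellation are proved together: each provides the
    induction hypothesis that the other one needs. *)
Lemma gle_add2l x y z : gle (gadd x y) (gadd x z) <-> gle y z.
Proof.
pose T y z := gle (gadd x y) (gadd x z) <-> gle y z.
suff: T y z /\ T z y by case.
rewrite {}/T.
elim/game_opt_ind: x y z => x IHx; elim/game_opt_ind=> y IHy.
elim/game_opt_ind=> z IHz.
have addl s t o : option_of s x o -> option_of s (gadd x t) (gadd o t).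
  by move=> oo; apply/opt_add; left; exists o.
have addr s t o : option_of s t o -> option_of s (gadd x t) (gadd x o).
  by move=> oo; apply/opt_add; right; exists o.
split; (split=> le; apply: gle_intro => o oo le_o).
- exact/(gle_lopt le (addr _ _ _ oo))/(IHy _ _ oo z).2.2.
- exact/(gle_ropt le (addr _ _ _ oo))/(IHz _ _ oo).2.2.
- case/opt_add: oo le_o => -[o' oo ->] le_o.
    have h := (IHx _ _ oo y z).1.2 le.
    exact: (lopt_nge (addl _ z _ oo)) (gle_trans le_o h).
  exact/(gle_lopt le oo)/(IHy _ _ oo z).2.1.
- case/opt_add: oo le_o => -[o' oo ->] le_o.
    have h := (IHx _ _ oo y z).1.2 le.
    exact: (ropt_nle (addl _ y _ oo)) (gle_trans h le_o).
  exact/(gle_ropt le oo)/(IHz _ _ oo).2.1.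
- exact/(gle_lopt le (addr _ _ _ oo))/(IHz _ _ oo).1.2.
- exact/(gle_ropt le (addr _ _ _ oo))/(IHy _ _ oo z).1.2.
- case/opt_add: oo le_o => -[o' oo ->] le_o.
    have h := (IHx _ _ oo y z).2.2 le.
    exact: (lopt_nge (addl _ y _ oo)) (gle_trans le_o h).
  exact/(gle_lopt le oo)/(IHz _ _ oo).1.1.
- case/opt_add: oo le_o => -[o' oo ->] le_o.
    have h := (IHx _ _ oo y z).2.2 le.
    exact: (ropt_nle (addl _ z _ oo)) (gle_trans h le_o).
  exact/(gle_ropt le oo)/(IHy _ _ oo z).1.1.
Qed.

(** * Deciding identities of abelian groups *)

Section TrivialExtension.
Variable V : zmodType.
Local Open Scope ring_scope.

(** The ring in which [int] acts on [V] and [V] has square zero.  An abelian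
    group embeds into it, so that [ring] proves the identities of [V]. *)
Definition trivial_ext : Type := (int * V)%type.
HB.instance Definition _ := GRing.Zmodule.on trivial_ext.

Definition trivial_ext_one : trivial_ext := (1, 0).
Definition trivial_ext_mul (a b : trivial_ext) : trivial_ext :=
  (a.1 * b.1, b.2 *~ a.1 + a.2 *~ b.1).

Fact trivial_ext_mulA : associative trivial_ext_mul.
Proof.
move=> [a u] [b v] [c w]; congr (_, _) => /=; first by rewrite mulrA.
by rewrite !mulrzDl -!mulrzA addrA (mulrC b a) (mulrC c a).
Qed.
Fact trivial_ext_mulC : commutative trivial_ext_mul.
Proof. by move=> [a u] [b v]; congr (_, _); [apply: mulrC | apply: addrC]. Qed.
Fact trivial_ext_mul1 : left_id trivial_ext_one trivial_ext_mul.
Proof. by move=> [a u]; congr (_, _) => /=; rewrite ?mul1r // mul0rz addr0. Qed.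
Fact trivial_ext_mulDl : left_distributive trivial_ext_mul +%R.
Proof.
move=> [a u] [b v] [c w]; congr (_, _) => /=; first by rewrite mulrDl.
by rewrite mulrzDr mulrzDl addrACA.
Qed.
Fact trivial_ext_1neq0 : trivial_ext_one != 0.
Proof. by []. Qed.
HB.instance Definition _ := GRing.Zmodule_isComNzRing.Build trivial_ext
  trivial_ext_mulA trivial_ext_mulC trivial_ext_mul1 trivial_ext_mulDl
  trivial_ext_1neq0.

Definition trivial_ext_in (u : V) : trivial_ext := (0, u).
Fact trivial_ext_in_is_additive : zmod_morphism trivial_ext_in.
Proof. by move=> u v; congr (_, _); rewrite subr0. Qed.
HB.instance Definition _ := GRing.isZmodMorphism.Build V trivial_ext
  trivial_ext_in trivial_ext_in_is_additive.

Lemma trivial_ext_in_inj : injective trivial_ext_in.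
Proof. by move=> u v []. Qed.

End TrivialExtension.

Ltac abel := apply: trivial_ext_in_inj; ring.

(** * The abelian group of games *)

HB.instance Definition _ := gen_eqMixin game.
HB.instance Definition _ := gen_choiceMixin game.

Definition geqvb : rel game := fun x y => `[< geqv x y >].

Lemma geqvb_equiv : equiv_class_of geqvb.
Proof.
split=> [x|x y|y x z]; first exact/asboolP/geqv_refl.
  by apply/asboolP/asboolP; apply: geqv_sym.
by move=> /asboolP xy /asboolP yz; apply/asboolP; apply: geqv_trans yz.
Qed.

Canonical geqvb_equivrel := EquivRelPack geqvb_equiv.

(** The quotient is taken on all games and the numbers are singled out
    afterwards: the ring identities hold for the products of arbitrary games, so
    their proofs need not carry any condition on the options. *)
Definition gclass : Type := {eq_quot geqvb}%qT.
HB.instance Definition _ := Choice.on gclass.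
HB.instance Definition _ := Quotient.on gclass.

Definition cls (x : game) : gclass := \pi_gclass%qT x.

Lemma cls_eq x y : cls x = cls y <-> geqv x y.
Proof. by split=> [/eqmodP/asboolP|h]; last apply/eqmodP/asboolP. Qed.

Lemma cls_ind (P : gclass -> Prop) : (forall x, P (cls x)) -> forall z, P z.
Proof. by move=> H z; rewrite -(reprK z); apply: H. Qed.

Definition crepr (z : gclass) : game := repr z.

Lemma creprK z : cls (crepr z) = z. Proof. exact: reprK. Qed.

Lemma crepr_cls x : geqv (crepr (cls x)) x.
Proof. by apply/cls_eq; rewrite creprK. Qed.

Section GclassGroup.
Local Open Scope ring_scope.

Definition gclass_add (z w : gclass) := cls (gadd (crepr z) (crepr w)).
Definition gclass_opp (z : gclass) := cls (gopp (crepr z)).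

Lemma geqv_add x y x' y' : geqv x x' -> geqv y y' -> geqv (gadd x y) (gadd x' y').
Proof.
have add2 z t t' : geqv t t' -> geqv (gadd z t) (gadd z t').
  by case=> h1 h2; split; apply/gle_add2l.
move=> hx hy; apply: geqv_trans (add2 x' _ _ hy).
by apply: geqv_trans (gaddC _ _); apply: geqv_trans (gaddC _ _) (add2 _ _ _ hx).
Qed.

Lemma clsD_subproof x y : cls (gadd x y) = gclass_add (cls x) (cls y).
Proof. by apply/cls_eq/geqv_add; apply/geqv_sym/crepr_cls. Qed.

Lemma clsN_subproof x : cls (gopp x) = gclass_opp (cls x).
Proof. by apply/cls_eq; case: (crepr_cls x) => h1 h2; split; apply/gle_opp. Qed.

Fact gclass_addA : associative gclass_add.
Proof.
elim/cls_ind=> x; elim/cls_ind=> y; elim/cls_ind=> z.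
by rewrite -!clsD_subproof; apply/cls_eq/gaddA.
Qed.
Fact gclass_addC : commutative gclass_add.
Proof.
elim/cls_ind=> x; elim/cls_ind=> y.
by rewrite -!clsD_subproof; apply/cls_eq/gaddC.
Qed.
Fact gclass_add0 : left_id (cls gzero) gclass_add.
Proof. by elim/cls_ind=> x; rewrite -clsD_subproof; apply/cls_eq/gadd0. Qed.
Fact gclass_addN : left_inverse (cls gzero) gclass_opp gclass_add.
Proof.
elim/cls_ind=> x; rewrite -clsN_subproof -clsD_subproof; apply/cls_eq.
exact: geqv_trans (gaddC _ _) (gaddN _).
Qed.
HB.instance Definition _ := GRing.isZmodule.Build gclass
  gclass_addA gclass_addC gclass_add0 gclass_addN.

Lemma cls0 : cls gzero = 0. Proof. by []. Qed.
Lemma clsD x y : cls (gadd x y) = cls x + cls y.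
Proof. exact: clsD_subproof. Qed.
Lemma clsN x : cls (gopp x) = - cls x.
Proof. exact: clsN_subproof. Qed.
Lemma clsB x y : cls (gsub x y) = cls x - cls y.
Proof. by rewrite clsD clsN. Qed.

Definition gclass_le (z w : gclass) := `[< gle (crepr z) (crepr w) >].

Lemma gclass_leE x y : gclass_le (cls x) (cls y) = `[< gle x y >].
Proof.
have [h1 h2] := crepr_cls x; have [h3 h4] := crepr_cls y.
apply/asboolP/asboolP => h.
  exact: gle_trans (gle_trans h h3).
exact: gle_trans (gle_trans h h4).
Qed.

Fact gclass_le_refl : reflexive gclass_le.
Proof. by elim/cls_ind=> x; rewrite gclass_leE; apply/asboolP/gle_refl. Qed.
Fact gclass_le_anti : antisymmetric gclass_le.
Proof.
elim/cls_ind=> x; elim/cls_ind=> y; rewrite !gclass_leE.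
by case/andP=> /asboolP xy /asboolP yx; apply/cls_eq.
Qed.
Fact gclass_le_trans : transitive gclass_le.
Proof.
elim/cls_ind=> y; elim/cls_ind=> x; elim/cls_ind=> z; rewrite !gclass_leE.
by move=> /asboolP xy /asboolP yz; apply/asboolP; apply: gle_trans yz.
Qed.
HB.instance Definition _ := Order.Le_isPOrder.Build ring_display gclass
  gclass_le_refl gclass_le_anti gclass_le_trans.

Lemma cls_leP x y : reflect (gle x y) (cls x <= cls y).
Proof. by rewrite /Order.le /= gclass_leE; apply: asboolP. Qed.

Lemma cls_ltP x y : reflect (glt x y) (cls x < cls y).
Proof.
rewrite lt_leAnge; apply: (iffP andP) => -[h1 h2].
  by split; [apply/cls_leP | move/cls_leP; apply/negP].
by split; [apply/cls_leP | apply/negP => /cls_leP].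
Qed.

Lemma gclass_leD2l (u v w : gclass) : (u + v <= u + w) = (v <= w).
Proof.
elim/cls_ind: u => x; elim/cls_ind: v => y; elim/cls_ind: w => z.
by rewrite -!clsD; apply/cls_leP/cls_leP => /gle_add2l.
Qed.

Lemma gclass_subr_ge0 (u v : gclass) : (0 <= v - u) = (u <= v).
Proof. by rewrite -(gclass_leD2l u 0) addr0 addrC subrK. Qed.

Lemma gclass_subr_gt0 (u v : gclass) : (0 < v - u) = (u < v).
Proof. by rewrite !lt_neqAle gclass_subr_ge0 eq_sym subr_eq0 eq_sym. Qed.

Lemma gclass_addr_gt0 (u v : gclass) : 0 < u -> 0 <= v -> 0 < u + v.
Proof.
move=> u0 v0; apply: lt_le_trans u0 _.
by rewrite -{1}[u]addr0 gclass_leD2l.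
Qed.

End GclassGroup.

(** * Products of games *)

Definition mulopt (x y x' y' : game) : game :=
  gsub (gadd (gmul x' y) (gmul x y')) (gmul x' y').

Lemma opt_mulP s x y o : option_of s (gmul x y) o ->
  exists t u x' y', [/\ s = t (+) u, option_of t x x', option_of u y y' &
    o = mulopt x y x' y'].
Proof.
case/opt_mul=> t [x' [y' [ox oy ->]]].
by exists t, (s (+) t), x', y'; split=> //; rewrite addbC -addbA addbb addbF.
Qed.

Lemma opt_mulI t u x y x' y' : option_of t x x' -> option_of u y y' ->
  option_of (t (+) u) (gmul x y) (mulopt x y x' y').
Proof.
move=> ox oy; apply/opt_mul; exists t, x', y'; split=> //.
by rewrite addbAC addbb.
Qed.

Section GameProduct.
Local Open Scope ring_scope.

Local Notation m x y := (cls (gmul x y)).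

Lemma cls_mulopt x y x' y' : cls (mulopt x y x' y') = m x' y + m x y' - m x' y'.
Proof. by rewrite clsB clsD. Qed.

Lemma cls_opt x y :
  (forall s o, option_of s x o -> exists2 o', option_of s y o' & cls o = cls o') ->
  (forall s o, option_of s y o -> exists2 o', option_of s x o' & cls o = cls o') ->
  cls x = cls y.
Proof.
move=> hx hy; apply/cls_eq/geqv_opt => s o oo.
  by have [o' oo' /cls_eq] := hx _ _ oo; exists o'.
by have [o' oo' /cls_eq/geqv_sym] := hy _ _ oo; exists o'.
Qed.

Lemma cls_mulC x y : m x y = m y x.
Proof.
elim/game_opt_ind: x y => x IHx; elim/game_opt_ind=> y IHy.
apply: cls_opt => s _ /opt_mulP[t [u [o1 [o2 [-> oo1 oo2 ->]]]]].
  exists (mulopt y x o2 o1); first by rewrite addbC; apply: opt_mulI.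
  rewrite !cls_mulopt (IHx _ _ oo1 y) (IHx _ _ oo1 o2) (IHy _ _ oo2); abel.
exists (mulopt x y o2 o1); first by rewrite addbC; apply: opt_mulI.
rewrite !cls_mulopt (IHx _ _ oo2 y) (IHx _ _ oo2 o1) (IHy _ _ oo1); abel.
Qed.

Lemma cls_mulN x y : m (gopp x) y = - m x y.
Proof.
rewrite -clsN.
elim/game_opt_ind: x y => x IHx; elim/game_opt_ind=> y IHy.
have E x' y' t u : option_of t x x' -> option_of u y y' ->
    cls (mulopt (gopp x) y (gopp x') y') = cls (gopp (mulopt x y x' y')).
  move=> ox oy; rewrite clsN !cls_mulopt (IHx _ _ ox) (IHy _ _ oy) (IHx _ _ ox).
  rewrite !clsN; abel.
apply: cls_opt => s o.
  case/opt_mulP=> t [u [o1 [o2 [-> /opt_opp[x' ox ->] oo2 ->]]]].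
  exists (gopp (mulopt x y x' o2)); last exact: E ox oo2.
  apply/opt_opp; exists (mulopt x y x' o2) => //.
  by rewrite -addNb; apply: opt_mulI.
case/opt_opp=> o1 /opt_mulP[t [u [x' [o2 [e ox oo2 ->]]]]] ->.
exists (mulopt (gopp x) y (gopp x') o2); last by rewrite (E _ _ _ _ ox oo2).
rewrite -[s]negbK e -addNb; apply: opt_mulI => //.
by apply/opt_opp; exists x'; rewrite ?negbK.
Qed.

Lemma cls_mulDl x y z : m (gadd x y) z = m x z + m y z.
Proof.
rewrite -clsD.
elim/game_opt_ind: x y z => x IHx; elim/game_opt_ind=> y IHy.
elim/game_opt_ind=> z IHz.
have Ex x' z' t u : option_of t x x' -> option_of u z z' ->
    cls (mulopt (gadd x y) z (gadd x' y) z') =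
    cls (gadd (mulopt x z x' z') (gmul y z)).
  move=> ox oz; rewrite clsD !cls_mulopt (IHx _ _ ox) (IHz _ _ oz) (IHx _ _ ox).
  rewrite !clsD; abel.
have Ey y' z' t u : option_of t y y' -> option_of u z z' ->
    cls (mulopt (gadd x y) z (gadd x y') z') =
    cls (gadd (gmul x z) (mulopt y z y' z')).
  move=> ox oz; rewrite clsD !cls_mulopt (IHy _ _ ox) (IHz _ _ oz) (IHy _ _ ox).
  rewrite !clsD; abel.
apply: cls_opt => s o.
  case/opt_mulP=> t [u [o1 [o2 [-> /opt_add[[x' ox ->]|[x' ox ->]] oo2 ->]]]].
    exists (gadd (mulopt x z x' o2) (gmul y z)); last exact: Ex ox oo2.
    by apply/opt_add; left; exists (mulopt x z x' o2) => //; apply: opt_mulI.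
  exists (gadd (gmul x z) (mulopt y z x' o2)); last exact: Ey ox oo2.
  by apply/opt_add; right; exists (mulopt y z x' o2) => //; apply: opt_mulI.
case/opt_add=> -[o1 /opt_mulP[t [u [x' [o2 [-> ox oo2 ->]]]]] ->].
  exists (mulopt (gadd x y) z (gadd x' y) o2); last by rewrite (Ex _ _ _ _ ox oo2).
  by apply: opt_mulI => //; apply/opt_add; left; exists x'.
exists (mulopt (gadd x y) z (gadd x x') o2); last by rewrite (Ey _ _ _ _ ox oo2).
by apply: opt_mulI => //; apply/opt_add; right; exists x'.
Qed.

Lemma cls_mulDr x y z : m x (gadd y z) = m x y + m x z.
Proof. by rewrite cls_mulC cls_mulDl !(cls_mulC x). Qed.

Lemma cls_mulNr x y : m x (gopp y) = - m x y.
Proof. by rewrite cls_mulC cls_mulN (cls_mulC x). Qed.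

Lemma cls_mulA x y z : m x (gmul y z) = m (gmul x y) z.
Proof.
elim/game_opt_ind: x y z => x IHx; elim/game_opt_ind=> y IHy.
elim/game_opt_ind=> z IHz.
have E x' y' z' t u v : option_of t x x' -> option_of u y y' -> option_of v z z' ->
    cls (mulopt x (gmul y z) x' (mulopt y z y' z')) =
    cls (mulopt (gmul x y) z (mulopt x y x' y') z').
  move=> ox oy oz; rewrite !cls_mulopt !(cls_mulDl, cls_mulDr, cls_mulN, cls_mulNr).
  rewrite !(IHx _ _ ox) !(IHy _ _ oy) (IHz _ _ oz); abel.
apply: cls_opt => s o.
  case/opt_mulP=> t [u' [x' [o1 [-> ox /opt_mulP[u [v [y' [z' [-> oy oz ->]]]]] ->]]]].
  exists (mulopt (gmul x y) z (mulopt x y x' y') z'); last exact: E ox oy oz.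
  by rewrite addbA; apply: opt_mulI => //; apply: opt_mulI.
case/opt_mulP=> u' [v [o1 [z' [-> /opt_mulP[t [u [x' [y' [-> ox oy ->]]]]] oz ->]]]].
exists (mulopt x (gmul y z) x' (mulopt y z y' z')); last by rewrite (E _ _ _ _ _ _ ox oy oz).
by rewrite -addbA; apply: opt_mulI => //; apply: opt_mulI.
Qed.

Lemma cls_mul0 x : m gzero x = 0.
Proof.
by rewrite -cls0; apply: cls_opt => s o; [case/opt_mulP=> t [u [o1 [o2 []]]] _ | ];
  move/opt_zero.
Qed.

Lemma cls_mul1 x : m gone x = cls x.
Proof.
elim/game_opt_ind: x => x IH.
have E x' t : option_of t x x' -> cls (mulopt gone x gzero x') = cls x'.
  by move=> ox; rewrite cls_mulopt !cls_mul0 (IH _ _ ox) add0r subr0.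
apply: cls_opt => s o.
  case/opt_mulP=> t [u [o1 [x' [-> /opt_one[/negPf-> ->] ox ->]]]].
  by exists x'; last exact: E ox.
move=> ox; exists (mulopt gone x gzero o); last by rewrite (E _ _ ox).
by rewrite -[s]addFb; apply: opt_mulI => //; apply/opt_one.
Qed.

End GameProduct.

(** * Numbers *)

Section Numbers.
Local Open Scope ring_scope.

Lemma numericE x : numeric x <->
  (forall xl xr, option_of false x xl -> option_of true x xr -> ~ gle xr xl) /\
  (forall s x', option_of s x x' -> numeric x').
Proof.
case: x => L R xL xR /=; split.
  case=> lt_lr nl nr; split; first by move=> _ _ [i <-] [j <-]; apply: lt_lr.
  by case=> _ [i <-]; [apply: nr | apply: nl].
case=> lt_lr n; split.
- by move=> i j; apply: lt_lr; [exists i | exists j].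
- by move=> i; apply: (n false); exists i.
- by move=> j; apply: (n true); exists j.
Qed.

Lemma numericI x :
  (forall xl xr, option_of false x xl -> option_of true x xr -> cls xl < cls xr) ->
  (forall s x', option_of s x x' -> numeric x') -> numeric x.
Proof.
by move=> lt_lr n; apply/numericE; split=> // xl xr ol or; have /cls_ltP[] := lt_lr _ _ ol or.
Qed.

Lemma numeric_opt s x x' : numeric x -> option_of s x x' -> numeric x'.
Proof. by case/numericE=> _; apply. Qed.

(** The order of the side [s]: an option of a number [x] on the side [s]
    precedes [x] for it. *)
Definition lt_on (s : bool) (u v : gclass) : bool := if s then v < u else u < v.

(** The definition only asks that left options be less than right ones; that
    the number lies between them is a consequence. *)
Lemma numeric_opt_lt s x x' : numeric x -> option_of s x x' ->
  lt_on s (cls x') (cls x).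
Proof.
elim/game_opt_ind: x s x' => x IH s x' nx ox; have [lt_lr n] := (numericE x).1 nx.
case: s ox => ox; apply/cls_ltP; split.
- apply: gle_intro => o oo le_o; first exact: lt_lr oo ox le_o.
  apply: (ropt_nle ox); apply: gle_trans le_o.
  by have /cls_ltP[] := IH _ _ ox _ _ (n _ _ ox) oo.
- exact: ropt_nle.
- apply: gle_intro => o oo le_o; last exact: lt_lr ox oo le_o.
  apply: (lopt_nge ox); apply: gle_trans le_o _.
  by have /cls_ltP[] := IH _ _ ox _ _ (n _ _ ox) oo.
- exact: lopt_nge.
Qed.

(** A failure of [y <= x] is witnessed by an option that lies between them. *)
Lemma ngle_between x y : ~ gle y x ->
  (exists2 x', option_of true x x' & cls x' <= cls y) \/
  (exists2 y', option_of false y y' & cls x <= cls y').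
Proof.
move=> nle; apply: contrapT => /not_orP[hx hy]; apply: nle.
apply: gle_intro => o oo le_o; [apply: hy | apply: hx]; exists o => //;
exact/cls_leP.
Qed.

Lemma numeric_total x y : numeric x -> numeric y ->
  (cls x <= cls y) || (cls y <= cls x).
Proof.
move=> nx ny; case: (pselect (gle y x)) => [/cls_leP->|/ngle_between]; first by rewrite orbT.
case=> -[o oo le_o]; apply/orP; left.
  exact/ltW/(lt_le_trans (numeric_opt_lt nx oo) le_o).
exact/ltW/(le_lt_trans le_o (numeric_opt_lt ny oo)).
Qed.

Lemma numeric0 : numeric gzero.
Proof. by apply/numericE; split=> [? ? /opt_zero|? ? /opt_zero]. Qed.

Lemma numeric1 : numeric gone.
Proof.
apply/numericE; split=> [? ? _ /opt_one[]//|s x' /opt_one[_ ->]].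
exact: numeric0.
Qed.

Lemma numeric_opp x : numeric x -> numeric (gopp x).
Proof.
elim/game_opt_ind: x => x IH /numericE[lt_lr n]; apply/numericE; split.
  move=> _ _ /opt_opp[xr or ->] /opt_opp[xl ol ->] /gle_opp; exact: lt_lr.
by move=> s _ /opt_opp[x' ox ->]; apply: (IH _ _ ox); apply: n ox.
Qed.

Lemma gclass_ltD2l (u v w : gclass) : (u + v < u + w) = (v < w).
Proof. by rewrite !lt_neqAle gclass_leD2l (inj_eq (addrI u)). Qed.

Lemma lt_onD2l s (u v w : gclass) : lt_on s (u + v) (u + w) = lt_on s v w.
Proof. by case: s => /=; rewrite gclass_ltD2l. Qed.

Lemma numeric_add x y : numeric x -> numeric y -> numeric (gadd x y).
Proof.
elim/game_opt_ind: x y => x IHx; elim/game_opt_ind=> y IHy nx ny.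
have lt_opt s o : option_of s (gadd x y) o -> lt_on s (cls o) (cls x + cls y).
  case/opt_add=> -[o' oo ->]; rewrite clsD.
    by rewrite !(addrC _ (cls y)) lt_onD2l; apply: numeric_opt_lt oo.
  by rewrite lt_onD2l; apply: numeric_opt_lt oo.
apply: numericI => [xl xr /lt_opt ol /lt_opt|]; first exact: lt_trans.
move=> s _ /opt_add[[o oo ->]|[o oo ->]].
  exact: (IHx _ _ oo _ (numeric_opt nx oo)).
exact: (IHy _ _ oo _ (numeric_opt ny oo)).
Qed.

Lemma numeric_sub x y : numeric x -> numeric y -> numeric (gsub x y).
Proof. by move=> nx ny; apply: numeric_add => //; apply: numeric_opp. Qed.

(** * Products of numbers *)

Local Notation m x y := (cls (gmul x y)).

(** The class of [(a - b) * (c - d)], expanded: no product of sums occurs, so it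
    only involves products to which an induction hypothesis applies. *)
Definition cross (a b c d : game) : gclass := m a c - m b c - (m a d - m b d).

Definition sgb (s : bool) (u : gclass) : gclass := if s then - u else u.

Lemma sgbD s u v : sgb s (u + v) = sgb s u + sgb s v.
Proof. by case: s => //=; rewrite opprD. Qed.

Lemma sgbN s u : sgb s (- u) = sgb (~~ s) u.
Proof. by case: s => //=; rewrite opprK. Qed.

Lemma cross_swap a b c d : cross a b c d = - cross b a c d.
Proof. rewrite /cross; abel. Qed.

Lemma cross_cat a b e c d : cross a b c d = cross a e c d + cross e b c d.
Proof. rewrite /cross; abel. Qed.

Lemma crossC a b c d : cross a b c d = cross c d a b.
Proof. rewrite /cross !(cls_mulC c) !(cls_mulC d); abel. Qed.

(** The two properties that are proved by simultaneous induction: [x * y] lies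
    between its options, and multiplication by [y] respects equality and
    order, the order being tested against the options of [y] only. *)
Definition mul_cut (x y : game) : Prop := forall t u x' y',
  option_of t x x' -> option_of u y y' -> 0 < sgb (t (+) u) (cross x x' y y').

Definition mul_mono (x1 x2 y : game) : Prop :=
  (cls x1 = cls x2 -> m x1 y = m x2 y) /\
  (cls x1 < cls x2 -> forall u y', option_of u y y' -> 0 < sgb u (cross x2 x1 y y')).

Lemma mul_cutC x y : mul_cut x y -> mul_cut y x.
Proof. by move=> H t u y' x' oy ox; rewrite crossC addbC; apply: H. Qed.

Lemma numeric_mul_cut x y : numeric (gmul x y) -> mul_cut x y.
Proof.
move=> n t u x' y' ox oy; have := numeric_opt_lt n (opt_mulI ox oy).
have -> : cross x x' y y' = m x y - cls (mulopt x y x' y').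
  by rewrite cls_mulopt /cross; abel.
by case: (t (+) u) => /= h; rewrite ?opprB gclass_subr_gt0.
Qed.

Lemma mul_mono_lt_on s x1 x2 y u y' : mul_mono x1 x2 y -> mul_mono x2 x1 y ->
  lt_on s (cls x1) (cls x2) -> option_of u y y' ->
  0 < sgb (s (+) u) (cross x2 x1 y y').
Proof.
case: s => -[_ m12] [_ m21] lt12 oy; last exact: m12.
by rewrite cross_swap sgbN addTb negbK; apply: m21.
Qed.

(** For equal numbers [x1] and [x2], an option [x'] of [x1] lies on its side of
    [x2] too, so monotonicity places the options of [x1 * y] around [x2 * y];
    exchanging [x1] and [x2], the two products are equal. *)
Lemma mulopt_lt_eqv x1 x2 y : numeric x1 -> cls x1 = cls x2 ->
  (forall t x', option_of t x1 x' -> mul_mono x' x2 y /\ mul_mono x2 x' y) ->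
  (forall u y', option_of u y y' -> mul_mono x1 x2 y') ->
  forall s o, option_of s (gmul x1 y) o -> lt_on s (cls o) (m x2 y).
Proof.
move=> n1 e12 IH HE s o /opt_mulP[t [u [x' [y' [-> ox oy ->]]]]].
have [m1 m2] := IH _ _ ox.
have lt' : lt_on t (cls x') (cls x2) by rewrite -e12; apply: numeric_opt_lt.
have := mul_mono_lt_on m1 m2 lt' oy.
have -> : cross x2 x' y y' = m x2 y - cls (mulopt x1 y x' y').
  rewrite cls_mulopt (HE _ _ oy).1 // /cross; abel.
by case: (t (+) u) => /=; rewrite ?opprB gclass_subr_gt0.
Qed.

(** The case [x1 = x2] is [mulopt_lt_eqv].  If [x1 < x2], an option [o] of [x1] or
    [x2] lies between them; [cross x2 x1] splits at [o], where one part is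
    positive because a product lies between its options, and the other is
    nonnegative by induction.  The set [S] lets the same argument serve with
    hypotheses on the numbers that come before a given one only. *)
Lemma mul_mono_step (S : game -> Prop) y :
  (forall x, S x -> numeric x) ->
  (forall x s x', S x -> option_of s x x' -> S x') ->
  (forall x, S x -> mul_cut x y) ->
  (forall u y', option_of u y y' -> forall x1 x2, S x1 -> S x2 -> mul_mono x1 x2 y') ->
  forall x1 x2, S x1 -> S x2 -> mul_mono x1 x2 y.
Proof.
move=> nS hS HD HE x1 x2 s1 s2.
suff: mul_mono x1 x2 y /\ mul_mono x2 x1 y by case.
elim/game_opt_ind: x1 x2 s1 s2 => x1 IH1; elim/game_opt_ind=> x2 IH2 s1 s2.
have {}IH1 t x' : option_of t x1 x' -> mul_mono x' x2 y /\ mul_mono x2 x' y.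
  by move=> ox; apply: (IH1 _ _ ox) => //; apply: hS ox.
have {}IH2 t x' : option_of t x2 x' -> mul_mono x1 x' y /\ mul_mono x' x1 y.
  by move=> ox; apply: (IH2 _ _ ox) => //; apply: hS ox.
have eqv : cls x1 = cls x2 -> m x1 y = m x2 y.
  move=> e12.
  have lt1 : forall s o, option_of s (gmul x1 y) o -> lt_on s (cls o) (m x2 y).
    by apply: mulopt_lt_eqv => // [|u y' oy]; [apply: nS | apply: HE oy _ _ _ _].
  have lt2 : forall s o, option_of s (gmul x2 y) o -> lt_on s (cls o) (m x1 y).
    apply: mulopt_lt_eqv => // [|t x' /IH2[]//|u y' oy]; first exact: nS.
    exact: HE oy _ _ _ _.
  apply/cls_eq; split; apply: gle_intro => o.
  - by move/lt1/cls_ltP => -[].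
  - by move/lt2/cls_ltP => -[].
  - by move/lt2/cls_ltP => -[].
  - by move/lt1/cls_ltP => -[].
have mono (a b : game) : S a -> S b ->
    (forall t a', option_of t a a' -> mul_mono a' b y) ->
    (forall t b', option_of t b b' -> mul_mono a b' y) ->
    cls a < cls b -> forall u y', option_of u y y' -> 0 < sgb u (cross b a y y').
  move=> sa sb Ha Hb /cls_ltP[_ /ngle_between ltab] u y' oy.
  have le_ge0 c d : mul_mono c d y -> mul_mono c d y' -> cls c <= cls d ->
      0 <= sgb u (cross d c y y').
    move=> [e1 l1] [e2 l2]; rewrite le_eqVlt => /orP[/eqP e|lt].
      rewrite /cross e1 // e2 // !subrr; by case: (u); rewrite /= ?oppr0.
    exact/ltW/l1.
  case: ltab => -[o oo le_o].
    rewrite (cross_cat b a o) addrC sgbD; apply: gclass_addr_gt0.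
      rewrite cross_swap sgbN -addTb; exact: HD oo oy.
    apply: le_ge0 => //; first exact: Ha oo.
    by apply: HE oy _ _ _ _ => //; apply: hS oo.
  rewrite (cross_cat b a o) sgbD; apply: gclass_addr_gt0.
    by rewrite -[u]addFb; apply: HD oo oy.
  apply: le_ge0 => //; first exact: Hb oo.
  by apply: HE oy _ _ _ _ => //; apply: hS oo.
split; split=> //.
- by apply: mono => // t x' ox; [case: (IH1 _ _ ox) | case: (IH2 _ _ ox)].
- by move/esym/eqv.
- by apply: mono => // t x' ox; [case: (IH2 _ _ ox) | case: (IH1 _ _ ox)].
Qed.

(** Two options of [x * y] on opposite sides involve options on the same side of
    one factor, here [x], and on opposite sides of the other.  One passes from
    one of them to the other by changing one factor at a time,
    the order of the two changes depending on how [x1] compares with [x2].  The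
    lemma is stated for a function [T] of the two options, so that it serves
    whichever factor the common side belongs to. *)
Lemma product_options_lt (T : game -> game -> gclass) x y :
  numeric x -> numeric y ->
  (forall s u x1 x2 y', option_of s x x1 -> option_of s x x2 -> option_of u y y' ->
    (lt_on u (cls x1) (cls x2) -> T x1 y' < T x2 y') /\
    (cls x1 = cls x2 -> T x1 y' = T x2 y')) ->
  (forall t x' y1 y2, option_of t x x' -> option_of t y y1 ->
    option_of (~~ t) y y2 -> T x' y1 < T x' y2) ->
  forall t x1 x2 y1 y2, option_of t x x1 -> option_of t x x2 ->
    option_of t y y1 -> option_of (~~ t) y y2 -> T x1 y1 < T x2 y2.
Proof.
move=> nx ny Tx Ty t x1 x2 y1 y2 ox1 ox2 oy1 oy2.
have [lt1 e1] := Tx _ _ _ _ _ ox1 ox2 oy1.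
have [lt2 e2] := Tx _ _ _ _ _ ox1 ox2 oy2.
have ty1 := Ty _ _ _ _ ox1 oy1 oy2; have ty2 := Ty _ _ _ _ ox2 oy1 oy2.
have /orP := numeric_total (numeric_opt nx ox1) (numeric_opt nx ox2).
rewrite !le_eqVlt => -[]/orP[/eqP e|lt].
- by rewrite e1.
- case: (t) lt1 lt2 => /= h1 h2; [exact: lt_trans ty1 (h2 _)|exact: lt_trans (h1 _) ty2].
- by rewrite e1.
- case: (t) lt1 lt2 => /= h1 h2; [exact: lt_trans (h1 _) ty2|exact: lt_trans ty1 (h2 _)].
Qed.

Lemma numeric_mul_step x y : numeric x -> numeric y ->
  (forall s x', option_of s x x' -> numeric (gmul x' y)) ->
  (forall u y', option_of u y y' -> numeric (gmul x y')) ->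
  (forall s u x' y', option_of s x x' -> option_of u y y' -> numeric (gmul x' y')) ->
  (forall s t x1 x2, option_of s x x1 -> option_of t x x2 -> mul_mono x1 x2 y) ->
  (forall s t u x1 x2 y', option_of s x x1 -> option_of t x x2 ->
     option_of u y y' -> mul_mono x1 x2 y') ->
  (forall s t y1 y2, option_of s y y1 -> option_of t y y2 -> mul_mono y1 y2 x) ->
  (forall s t u y1 y2 x', option_of s y y1 -> option_of t y y2 ->
     option_of u x x' -> mul_mono y1 y2 x') ->
  numeric (gmul x y).
Proof.
move=> nx ny nxy' nx'y nx'y' Ex Ex' Ey Ey'.
have Tx s t u x1 x2 y' : option_of s x x1 -> option_of t x x2 -> option_of u y y' ->
    (lt_on u (cls x1) (cls x2) -> cls (mulopt x y x1 y') < cls (mulopt x y x2 y')) /\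
    (cls x1 = cls x2 -> cls (mulopt x y x1 y') = cls (mulopt x y x2 y')).
  move=> o1 o2 oy; split=> [lt|e].
    have := mul_mono_lt_on (Ex _ _ _ _ o1 o2) (Ex _ _ _ _ o2 o1) lt oy.
    rewrite addbb /= -gclass_subr_gt0.
    by congr (0 < _); rewrite !cls_mulopt /cross; abel.
  by rewrite !cls_mulopt (Ex _ _ _ _ o1 o2).1 ?(Ex' _ _ _ _ _ _ o1 o2 oy).1.
have Ty s t u y1 y2 x' : option_of s y y1 -> option_of t y y2 -> option_of u x x' ->
    (lt_on u (cls y1) (cls y2) -> cls (mulopt x y x' y1) < cls (mulopt x y x' y2)) /\
    (cls y1 = cls y2 -> cls (mulopt x y x' y1) = cls (mulopt x y x' y2)).
  move=> o1 o2 ox; split=> [lt|e].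
    have := mul_mono_lt_on (Ey _ _ _ _ o1 o2) (Ey _ _ _ _ o2 o1) lt ox.
    rewrite addbb /= -gclass_subr_gt0.
    by congr (0 < _); rewrite crossC !cls_mulopt /cross; abel.
  rewrite !cls_mulopt ![cls (gmul _ y1)]cls_mulC ![cls (gmul _ y2)]cls_mulC.
  by rewrite (Ey _ _ _ _ o1 o2).1 ?(Ey' _ _ _ _ _ _ o1 o2 ox).1.
have opp_lt z t z1 z2 : numeric z -> option_of t z z1 -> option_of (~~ t) z z2 ->
    lt_on t (cls z1) (cls z2).
  move=> nz o1 o2; have := numeric_opt_lt nz o1; have := numeric_opt_lt nz o2.
  case: (t) => /= h1 h2; [exact: lt_trans h2|exact: lt_trans h1].
apply: numericI; last first.
  move=> s _ /opt_mulP[t [u [x' [y' [_ ox oy ->]]]]].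
  apply: numeric_sub (nx'y' _ _ _ _ ox oy).
  exact: numeric_add (nxy' _ _ ox) (nx'y _ _ oy).
move=> ol or /opt_mulP[t1 [u1 [x1 [y1 [e1 ox1 oy1 {ol}->]]]]].
move=> /opt_mulP[t2 [u2 [x2 [y2 [e2 ox2 oy2 {or}->]]]]].
have {}e1 : u1 = t1 by case: (t1) (u1) e1 => -[].
have {}e2 : u2 = ~~ t2 by case: (t2) (u2) e2 => -[].
rewrite {}e1 {}e2 in oy1 oy2; have [e|ne] := eqVneq t1 t2.
  rewrite -{}e in ox2 oy2.
  pose T x' y' := cls (mulopt x y x' y').
  apply: (@product_options_lt T x y nx ny _ _ t1) => //.
    by move=> s u a1 a2 b h1 h2; apply: Tx h1 h2.
  move=> t x' b1 b2 ox o1 o2; apply: (Ty _ _ _ _ _ _ o1 o2 ox).1.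
  exact: opp_lt ny o1 o2.
have {}ne : t2 = ~~ t1 by case: (t1) (t2) ne => -[].
rewrite {}ne negbK in ox2 oy2.
pose T y' x' := cls (mulopt x y x' y').
apply: (@product_options_lt T y x ny nx _ _ t1) => //.
  by move=> s u a1 a2 b h1 h2; apply: Ty h1 h2.
move=> t y' b1 b2 oy o1 o2; apply: (Tx _ _ _ _ _ _ o1 o2 oy).1.
exact: opp_lt nx o1 o2.
Qed.

(** The transitive closure of being an option: it provides strong induction and
    the hereditary sets that [mul_mono_step] is applied to. *)
Inductive below : game -> game -> Prop :=
| below_opt s x x' : option_of s x x' -> below x' x
| below_trans s x x1 x' : option_of s x x1 -> below x' x1 -> below x' x.

Lemma game_below_ind (P : game -> Prop) :
  (forall x, (forall x', below x' x -> P x') -> P x) -> forall x, P x.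
Proof.
move=> IH x; suff [] : P x /\ forall x', below x' x -> P x' by [].
elim/game_opt_ind: x => x IHx.
have H x' : below x' x -> P x'.
  by move=> b; case: b IHx => [s y y' oy|s y y1 y' oy b] /(_ _ _ oy)[]; auto.
by split=> //; apply: IH.
Qed.

Lemma below_option x s x1 x2 : below x1 x -> option_of s x1 x2 -> below x2 x.
Proof.
elim=> [t y y' oy oo|t y y1 y' oy _ IH /IH]; last exact: below_trans oy.
exact: below_trans oy (below_opt oo).
Qed.

Lemma numeric_below x x' : numeric x -> below x' x -> numeric x'.
Proof.
by move=> + b; elim: b => [s y y' oy ny|s y y1 y' oy _ IH ny]; last apply: IH; apply: numeric_opt oy.
Qed.

(** Outer induction on [y], inner induction on [x].  To see that [x * y] is a
    number one compares products of options of [x] with [y], which by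
    [mul_mono_step] follows from the inner hypothesis, and products of options of
    [y] with [x], which follows from the outer one ([below_mono]).  Comparing
    arbitrary [x1 * y] and [x2 * y] comes last. *)
Lemma numeric_mul_mono y : numeric y ->
  (forall x, numeric x -> numeric (gmul x y)) /\
  (forall x1 x2, numeric x1 -> numeric x2 -> mul_mono x1 x2 y).
Proof.
elim/game_below_ind: y => y IHy ny.
have {}IHy y' : below y' y ->
  (forall x, numeric x -> numeric (gmul x y')) /\
  (forall x1 x2, numeric x1 -> numeric x2 -> mul_mono x1 x2 y').
  by move=> b; apply: IHy (numeric_below ny b).
have below_mono x : numeric x -> forall y1 y2, below y1 y -> below y2 y ->
    mul_mono y1 y2 x.
  elim/game_opt_ind: x => x IHx nx.
  apply: (@mul_mono_step (below^~ y)) => [z|z s z'|z bz|u x' ox].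
  - exact: numeric_below ny.
  - exact: below_option.
  - by apply/mul_cutC/numeric_mul_cut; apply: (IHy _ bz).1.
  - exact: IHx ox (numeric_opt nx ox).
have nxy x : numeric x -> numeric (gmul x y).
  elim/game_below_ind: x => x IHx nx.
  have mono : forall x1 x2, below x1 x -> below x2 x -> mul_mono x1 x2 y.
    apply: (@mul_mono_step (below^~ x)) => [z|z s z'|z bz|u y' oy x1 x2 b1 b2].
    - exact: numeric_below nx.
    - exact: below_option.
    - by apply: numeric_mul_cut; apply: IHx (numeric_below nx bz).
    - by apply: (IHy _ (below_opt oy)).2; apply: numeric_below nx _.
  apply: numeric_mul_step => //.
  - by move=> s x' /[dup] /below_opt + /(numeric_opt nx); apply: IHx.
  - by move=> u y' oy; apply: (IHy _ (below_opt oy)).1.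
  - by move=> s u x' y' ox oy; apply: (IHy _ (below_opt oy)).1; apply: numeric_opt ox.
  - by move=> s t x1 x2 /below_opt b1 /below_opt b2; apply: mono.
  - move=> s t u x1 x2 y' o1 o2 oy; apply: (IHy _ (below_opt oy)).2.
      exact: numeric_opt o1.
    exact: numeric_opt o2.
  - by move=> s t y1 y2 /below_opt b1 /below_opt b2; apply: below_mono.
  - move=> s t u y1 y2 x' /below_opt b1 /below_opt b2 ox.
    by apply: below_mono => //; apply: numeric_opt ox.
split=> //; apply: mul_mono_step => // [x s x'|x nx|u y' oy].
- exact: numeric_opt.
- exact/numeric_mul_cut/nxy.
- exact: (IHy _ (below_opt oy)).2.
Qed.

Lemma numeric_mul x y : numeric x -> numeric y -> numeric (gmul x y).
Proof. by move=> nx ny; apply: (numeric_mul_mono ny).1. Qed.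

Lemma cls_mul_eq x1 x2 y : numeric x1 -> numeric x2 -> numeric y ->
  cls x1 = cls x2 -> m x1 y = m x2 y.
Proof. by move=> n1 n2 ny; apply: ((numeric_mul_mono ny).2 _ _ n1 n2).1. Qed.

End Numbers.

(** * The ordered domain of numbers *)

Section SurrealRing.
Local Open Scope ring_scope.

Definition is_number : pred gclass := fun z => `[< exists2 x, numeric x & cls x = z >].

Fact is_number_zmod_closed : zmod_closed is_number.
Proof.
split=> [|_ _ /asboolP[x nx <-] /asboolP[y ny <-]]; apply/asboolP.
  by exists gzero; first exact: numeric0.
by exists (gsub x y); [apply: numeric_sub | apply: clsB].
Qed.
HB.instance Definition _ := GRing.isZmodClosed.Build gclass is_number
  is_number_zmod_closed.

Record No := MkNo { noval : gclass; _ : noval \in is_number }.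
HB.instance Definition _ := [isSub for noval].
HB.instance Definition _ := [Choice of No by <:].
HB.instance Definition _ := [SubChoice_isSubZmodule of No by <:].

(** Total on games, with a default value of 0, so that equations about [no]
    mention no proofs of being a number. *)
Definition no (x : game) : No := insubd 0 (cls x).

Lemma noE x : numeric x -> noval (no x) = cls x.
Proof. by move=> nx; rewrite [LHS]insubdK //; apply/asboolP; exists x. Qed.

Lemma no_ind (P : No -> Prop) : (forall x, numeric x -> P (no x)) -> forall z, P z.
Proof.
move=> H z; have /asboolP[x nx e] := valP z.
by have <- : no x = z; [apply: val_inj; rewrite -e; apply: noE | apply: H].
Qed.

Lemma no_surj z : exists s : surreal, no s = z.
Proof. by elim/no_ind: z => x nx; exists (Surreal nx). Qed.

Definition no_form (z : No) : surreal := projT1 (cid (no_surj z)).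

Lemma no_formK z : no (no_form z) = z.
Proof. by rewrite /no_form; case: cid. Qed.

Lemma noval_form z : cls (no_form z) = noval z.
Proof. by rewrite -noE ?no_formK //; apply: formP. Qed.

Lemma no_eq x y : numeric x -> numeric y -> cls x = cls y -> no x = no y.
Proof. by move=> nx ny e; apply: val_inj; rewrite /= !noE. Qed.

Lemma no0 : no gzero = 0.
Proof. by apply: val_inj; rewrite /= noE //; apply: numeric0. Qed.

Lemma no_add x y : numeric x -> numeric y -> no (gadd x y) = no x + no y.
Proof.
by move=> nx ny; apply: val_inj; rewrite /= !noE ?clsD //; apply: numeric_add.
Qed.

Lemma no_opp x : numeric x -> no (gopp x) = - no x.
Proof. by move=> nx; apply: val_inj; rewrite /= !noE ?clsN //; apply: numeric_opp. Qed.

Definition no_one : No := no gone.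
Definition no_mul (z w : No) : No := no (gmul (no_form z) (no_form w)).

Lemma no_mul_subproof x y : numeric x -> numeric y ->
  no (gmul x y) = no_mul (no x) (no y).
Proof.
move=> nx ny; have [fx fy] := (formP (no_form (no x)), formP (no_form (no y))).
have ex : cls x = cls (no_form (no x)) by rewrite noval_form noE.
have ey : cls y = cls (no_form (no y)) by rewrite noval_form noE.
apply: no_eq; [exact: numeric_mul | exact: numeric_mul | ].
rewrite (cls_mul_eq _ _ _ ex) // cls_mulC (cls_mul_eq _ _ _ ey) //.
exact: cls_mulC.
Qed.

Fact no_mulA : associative no_mul.
Proof.
elim/no_ind=> x nx; elim/no_ind=> y ny; elim/no_ind=> z nz.
rewrite -!no_mul_subproof //; try exact: numeric_mul.
by apply: no_eq; try (do !apply: numeric_mul => //); apply: cls_mulA.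
Qed.
Fact no_mulC : commutative no_mul.
Proof.
elim/no_ind=> x nx; elim/no_ind=> y ny; rewrite -!no_mul_subproof //.
by apply: no_eq; try (do !apply: numeric_mul => //); apply: cls_mulC.
Qed.
Fact no_mul1 : left_id no_one no_mul.
Proof.
elim/no_ind=> x nx; have n1 := numeric1.
rewrite -no_mul_subproof //; apply: no_eq => //; last exact: cls_mul1.
exact: numeric_mul.
Qed.
Fact no_mulDl : left_distributive no_mul +%R.
Proof.
elim/no_ind=> x nx; elim/no_ind=> y ny; elim/no_ind=> z nz.
have [nxz nyz] := (numeric_mul nx nz, numeric_mul ny nz).
have nxy := numeric_add nx ny.
rewrite -no_add // -!no_mul_subproof // -no_add //.
by apply: no_eq; [apply: numeric_mul | apply: numeric_add | rewrite cls_mulDl clsD].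
Qed.

Lemma cls_lt01 : 0 < cls gone.
Proof.
rewrite -cls0; apply: (numeric_opt_lt (s := false) numeric1).
by apply/opt_one.
Qed.

Fact no_1neq0 : no_one != 0.
Proof.
apply/eqP => /(congr1 noval); rewrite noE; last exact: numeric1.
by move=> e; have := cls_lt01; rewrite e ltxx.
Qed.
HB.instance Definition _ := GRing.Zmodule_isComNzRing.Build No
  no_mulA no_mulC no_mul1 no_mulDl no_1neq0.

Lemma no1 : no gone = 1. Proof. by []. Qed.

Lemma noM x y : numeric x -> numeric y -> no (gmul x y) = no x * no y.
Proof. exact: no_mul_subproof. Qed.

(** Between 0 and [y] lies a left option [y'] of [y], and
    [x * y = x * (y - y') + x * y']. *)
Lemma cls_mul_gt0 x y : numeric x -> numeric y -> 0 < cls x -> 0 < cls y ->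
  0 < cls (gmul x y).
Proof.
move=> nx + x0; elim/game_opt_ind: y => y IH ny y0.
have /cls_ltP[_ /ngle_between[[o /opt_zero//]|[y' oy le0y']]] : cls gzero < cls y.
  exact: y0.
have x0' : cls gzero < cls x := x0.
have mono := ((numeric_mul_mono ny).2 _ _ numeric0 nx).2 x0' _ _ oy.
have le0 : 0 <= cls (gmul x y').
  move: le0y'; rewrite le_eqVlt => /orP[/eqP e|lt]; last first.
    exact/ltW/(IH _ _ oy (numeric_opt ny oy)).
  rewrite cls_mulC -(cls_mul_eq numeric0 (numeric_opt ny oy) nx e).
  by rewrite cls_mul0.
have -> : cls (gmul x y) = cross x gzero y y' + cls (gmul x y').
  rewrite /cross !cls_mul0; abel.
exact: gclass_addr_gt0 mono le0.
Qed.

Definition no_le (z w : No) : bool := noval z <= noval w.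
Definition no_lt (z w : No) : bool := noval z < noval w.
Definition no_norm (z : No) : No := if no_le 0 z then z else - z.

Fact no_le0_add z w : no_le 0 z -> no_le 0 w -> no_le 0 (z + w).
Proof.
rewrite /no_le /= => z0 w0; apply: le_trans z0 _.
by rewrite -{1}[noval z]addr0 gclass_leD2l.
Qed.
Fact no_le0_anti z : no_le 0 z -> no_le z 0 -> z = 0.
Proof.
by rewrite /no_le => z0 z0'; apply: val_inj; apply: le_anti; rewrite /= z0 z0'.
Qed.
Fact no_sub_ge0 z w : no_le 0 (w - z) = no_le z w.
Proof. exact: gclass_subr_ge0. Qed.
Fact no_le0_total z : no_le 0 z || no_le z 0.
Proof.
elim/no_ind: z => x nx; rewrite /no_le noE // -[noval 0]/(cls gzero).
by apply: numeric_total => //; apply: numeric0.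
Qed.
Fact no_lt_def z w : no_lt z w = (w != z) && no_le z w.
Proof. exact: lt_def. Qed.
Fact no_normN z : no_norm (- z) = no_norm z.
Proof.
have e : no_le 0 (- z) = no_le z 0 by rewrite -[RHS]no_sub_ge0 sub0r.
rewrite /no_norm e opprK; case: ifP => z0; case: ifP => z0' //.
  by rewrite (no_le0_anti z0' z0) oppr0.
by have := no_le0_total z; rewrite z0 z0'.
Qed.
Fact no_ge0_norm z : no_le 0 z -> no_norm z = z.
Proof. by rewrite /no_norm => ->. Qed.
Fact no_mul_gt0 z w : no_lt 0 z -> no_lt 0 w -> no_lt 0 (z * w).
Proof.
elim/no_ind: z => x nx; elim/no_ind: w => y ny; rewrite -noM //.
rewrite /no_lt !noE //; last exact: numeric_mul.
exact: cls_mul_gt0.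
Qed.
Fact no_le0_mul z w : no_le 0 z -> no_le 0 w -> no_le 0 (z * w).
Proof.
move=> z0 w0; have [->|zn] := eqVneq z 0; first by rewrite mul0r /no_le.
have [->|wn] := eqVneq w 0; first by rewrite mulr0 /no_le.
by apply/ltW/no_mul_gt0; rewrite no_lt_def ?zn ?wn.
Qed.

(** The construction of inverses reasons in the ordered domain [No], whose
    structure comprises a choice of units and inverses: the units are therefore
    first taken to be whatever elements have an inverse. *)
Definition no_unit : pred No := fun z => `[< exists w, w * z = 1 >].
Definition no_inv (z : No) : No :=
  if pselect (exists w, w * z = 1) is left e then projT1 (cid e) else z.
Fact no_mulVx : {in no_unit, left_inverse 1 no_inv *%R}.
Proof. by move=> z /asboolP e; rewrite /no_inv; case: pselect => // e'; case: cid. Qed.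
Fact no_unitPl z w : w * z = 1 -> no_unit z.
Proof. by move=> e; apply/asboolP; exists w. Qed.
Fact no_inv_out : {in [predC no_unit], no_inv =1 id}.
Proof. by move=> z /asboolPn ne; rewrite /no_inv; case: pselect. Qed.
HB.instance Definition _ := GRing.ComNzRing_hasMulInverse.Build No
  no_mulVx no_unitPl no_inv_out.

Fact no_mulf_eq0 (z w : No) : z * w = 0 -> (z == 0) || (w == 0).
Proof.
move=> e; apply: contraT; rewrite negb_or => /andP[zn wn].
have nz (u : No) : u != 0 -> exists2 s, s = u \/ s = - u & no_lt 0 s.
  move=> un; have /orP[u0|u0] := no_le0_total u.
    by exists u; [left | rewrite no_lt_def un].
  exists (- u); first by right.
  by rewrite no_lt_def oppr_eq0 un -[- u]sub0r no_sub_ge0.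
have [s es s0] := nz _ zn; have [t et t0] := nz _ wn.
have := no_mul_gt0 s0 t0.
suff -> : s * t = 0 by rewrite /no_lt ltxx.
by case: es et => -> [] ->; rewrite ?mulrN ?mulNr e ?oppr0.
Qed.
HB.instance Definition _ := GRing.ComUnitRing_isIntegral.Build No no_mulf_eq0.

HB.instance Definition _ := Num.IntegralDomain_isLeReal.Build No
  no_le0_add no_le0_mul no_le0_anti no_sub_ge0 no_le0_total no_normN
  no_ge0_norm no_lt_def.

Lemma no_ltE x y : numeric x -> numeric y -> (no x < no y) = (cls x < cls y).
Proof. by move=> nx ny; rewrite -[LHS]/(noval _ < noval _) !noE. Qed.

Lemma no_leE x y : numeric x -> numeric y -> (no x <= no y) = (cls x <= cls y).
Proof. by move=> nx ny; rewrite -[LHS]/(noval _ <= noval _) !noE. Qed.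

(** * Inverses *)

Section Inverse.
Variable x : game.
Hypotheses (nx : numeric x) (x_gt0 : 0 < no x).
Hypothesis opt_unit : forall s x', option_of s x x' -> 0 < no x' ->
  no x' \is a GRing.unit.

(** Conway's options of [1 / x] are obtained from 0 by repeatedly replacing [v]
    with [(1 + (x' - x) * v) / x'], where [x'] is a positive option of [x]; they
    are indexed by the words on these options.  As
    [1 - x * v' = (x' - x) * (1 - x * v) / x'] for the new value [v'], a left
    option [x'] exchanges the two sides of [1 / x] and a right one keeps them. *)
Let pos_opt : Type := ({i : lidx x | 0 < no (lopt i)} + ridx x)%type.

Let opt_game (k : pos_opt) : game :=
  match k with inl i => lopt (sval i) | inr j => ropt j end.

Let opt_side (k : pos_opt) : bool := if k is inr _ then true else false.

Fixpoint inv_val (w : seq pos_opt) : No :=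
  if w is k :: w' then (1 + (no (opt_game k) - no x) * inv_val w') / no (opt_game k)
  else 0.

Fixpoint inv_side (w : seq pos_opt) : bool :=
  if w is k :: w' then opt_side k == inv_side w' else false.

Definition inv_game : game :=
  Game (fun w : {w | ~~ inv_side w} => no_form (inv_val (sval w)) : game)
       (fun w : {w | inv_side w} => no_form (inv_val (sval w)) : game).

Lemma opt_lt_on s x' : option_of s x x' -> if s then no x < no x' else no x' < no x.
Proof.
move=> ox; have := numeric_opt_lt nx ox; have := numeric_opt nx ox.
by case: s ox => ox nx' /=; rewrite no_ltE.
Qed.

Lemma opt_gameP k : [/\ option_of (opt_side k) x (opt_game k),
  0 < no (opt_game k) & no (opt_game k) \is a GRing.unit].
Proof.
have ox : option_of (opt_side k) x (opt_game k).
  by case: k => [i|j]; [exists (sval i) | exists j].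
suff k0 : 0 < no (opt_game k) by split=> //; apply: opt_unit ox k0.
case: k ox => [[i i0]|j] ox; first exact: i0.
exact: lt_trans x_gt0 (opt_lt_on ox).
Qed.

Lemma inv_val_lt w : if inv_side w then 1 < no x * inv_val w else no x * inv_val w < 1.
Proof.
elim: w => [|k w IH] /=; first by rewrite mulr0 ltr01.
have [ok k0 ku] := opt_gameP k; have lt_k := opt_lt_on ok.
set z := no (opt_game k) in k0 ku lt_k *.
have zi : 0 < z^-1 by rewrite invr_gt0.
set v := inv_val w in IH *; set X := no x in lt_k IH *.
have e : 1 - X * ((1 + (z - X) * v) / z) = (z - X) * (1 - X * v) * z^-1.
  rewrite -{1}(mulrV ku); ring.
case: (opt_side k) lt_k => lt_k; case: (inv_side w) IH => /= IH.
- by rewrite -subr_lt0 e pmulr_llt0 // pmulr_rlt0 ?subr_lt0 ?subr_gt0.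
- by rewrite -subr_gt0 e pmulr_lgt0 // pmulr_rgt0 ?subr_gt0.
- by rewrite -subr_gt0 e pmulr_lgt0 // nmulr_rgt0 ?subr_lt0.
- by rewrite -subr_lt0 e pmulr_llt0 // nmulr_rlt0 ?subr_lt0 ?subr_gt0.
Qed.

Lemma opt_inv s y' : option_of s inv_game y' ->
  exists w, [/\ inv_side w = s, numeric y' & no y' = inv_val w].
Proof.
case: s => -[[w sw] /= <-]; exists w; split=> //; rewrite ?no_formK //;
  by [exact: formP | exact/negbTE].
Qed.

Lemma inv_opt w : exists2 y', option_of (inv_side w) inv_game y' & no y' = inv_val w.
Proof.
case sw: (inv_side w); exists (no_form (inv_val w)); rewrite ?no_formK //.
  by exists (exist _ w sw).
by exists (exist _ w (negbT sw)).
Qed.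

Lemma numeric_inv_game : numeric inv_game.
Proof.
apply: numericI => [yl yr /opt_inv[w [sw nl el]] /opt_inv[w' [sw' nr er]]|].
  rewrite -no_ltE // el er -(ltr_pM2l x_gt0).
  by have := inv_val_lt w'; have := inv_val_lt w; rewrite sw sw'; apply: lt_trans.
by move=> s y' /opt_inv[w []].
Qed.

Lemma inv_val_lt_game w :
  if inv_side w then no inv_game < inv_val w else inv_val w < no inv_game.
Proof.
have [y' oy <-] := inv_opt w; have ny' := numeric_opt numeric_inv_game oy.
have := numeric_opt_lt numeric_inv_game oy; case: (inv_side w) => /=;
by rewrite no_ltE //; exact: numeric_inv_game.
Qed.

(** An option of [x * y] is [1 + x' * (y - y'')] for the option [y''] of [y]
    obtained from [x'] and [y'], unless [x'] is not positive; in both cases it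
    lies on its own side of 1. *)
Lemma inv_mul_opt s o : option_of s (gmul x inv_game) o ->
  if s then 1 < no o else no o < 1.
Proof.
have ny := numeric_inv_game.
case/opt_mulP=> t [u [x' [y' [-> ox /[dup] oy /opt_inv[w [sw ny' ey]] ->]]]].
have nx' := numeric_opt nx ox; have lt_x := opt_lt_on ox.
have -> : no (mulopt x inv_game x' y') =
    no x' * no inv_game + no x * inv_val w - no x' * inv_val w.
  by rewrite -ey no_add ?no_opp ?no_add ?noM //;
    do ?[apply: numeric_add|apply: numeric_opp|apply: numeric_mul].
have [x'_gt0|x'_le0] := ltP 0 (no x').
  have [k ek sk] : exists2 k, no (opt_game k) = no x' & opt_side k = t.
    case: t ox {lt_x} => -[i ei]; last subst x'.
      by exists (inr i); rewrite //= ei.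
    by exists (inl (exist _ i x'_gt0)).
  have lt_w := inv_val_lt_game (k :: w); rewrite /= sk sw ek in lt_w.
  have -> : no x' * no inv_game + no x * inv_val w - no x' * inv_val w =
      1 + no x' * (no inv_game - (1 + (no x' - no x) * inv_val w) / no x').
    have ku := opt_unit ox x'_gt0.
    by rewrite mulrBr mulrCA mulrV //; ring.
  set v := _ / _ in lt_w *; case: (t) (u) lt_w => -[] /= lt_w.
  - by rewrite gtrDl pmulr_rlt0 // subr_lt0.
  - by rewrite ltrDl pmulr_rgt0 // subr_gt0.
  - by rewrite ltrDl pmulr_rgt0 // subr_gt0.
  - by rewrite gtrDl pmulr_rlt0 // subr_lt0.
have t0 : t = false.
  by case: (t) lt_x => // /(lt_trans x_gt0); rewrite ltNge x'_le0.
have := inv_val_lt_game w; have := inv_val_lt w; rewrite sw t0 addFb.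
have -> : no x' * no inv_game + no x * inv_val w - no x' * inv_val w =
  no x * inv_val w + no x' * (no inv_game - inv_val w) by ring.
case: (u) => /= h1 h2.
  by rewrite (lt_le_trans h1) // lerDl mulr_le0 // subr_le0 ltW.
by rewrite (le_lt_trans _ h1) // gerDl mulr_le0_ge0 // subr_ge0 ltW.
Qed.

(** The options of [x * y] straddle 1, and 0, the only option of 1, is less than
    [x * y]: this is all that the equality asks for. *)
Lemma inv_gameE : no x * no inv_game = 1.
Proof.
have ny := numeric_inv_game; have nxy := numeric_mul nx ny.
have y_gt0 : 0 < no inv_game := inv_val_lt_game [::].
have n1 := numeric1.
rewrite -noM // -[1]/(no gone); apply: no_eq => //.
have opt_lt s o : option_of s (gmul x inv_game) o ->
    if s then cls gone < cls o else cls o < cls gone.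
  move=> oo; have := inv_mul_opt oo; have no_o := numeric_opt nxy oo.
  by rewrite -[1]/(no gone); case: s oo => _; rewrite no_ltE.
apply/cls_eq; split; apply: gle_intro => o.
- by move/opt_lt/cls_ltP => -[].
- by move/opt_one => [].
- case/opt_one=> _ ->; have /cls_ltP[] // : cls gzero < cls (gmul x inv_game).
  have n0 := numeric0.
  by rewrite -no_ltE // noM // no0 mulr_gt0.
- by move/opt_lt/cls_ltP => -[].
Qed.

End Inverse.

Lemma no_gt0_unit x : numeric x -> 0 < no x -> no x \is a GRing.unit.
Proof.
elim/game_opt_ind: x => x IH nx x0.
have opt_unit s x' : option_of s x x' -> 0 < no x' -> no x' \is a GRing.unit.
  by move=> ox; apply: (IH _ _ ox); apply: numeric_opt ox.
apply/unitrP; exists (no (inv_game x)).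
by rewrite mulrC (inv_gameE nx x0 opt_unit).
Qed.

Fact no_fieldP : GRing.field_axiom No.
Proof.
elim/no_ind=> x nx; rewrite neq_lt => /orP[x0|x0]; last exact: no_gt0_unit.
rewrite -unitrN -no_opp //; apply: no_gt0_unit; first exact: numeric_opp.
by rewrite no_opp // oppr_gt0.
Qed.
HB.instance Definition _ := GRing.UnitRing_isField.Build No no_fieldP.

End SurrealRing.

(** * The theorem of the alternative over an ordered field *)

Section Alternative.
Local Open Scope ring_scope.
Variable F : realFieldType.

(** Each inequality with [c a != 0] bounds [t] strictly from below or from above,
    and the second hypothesis says that the lower bounds are less than the upper
    ones; any [t] between their maximum [l] and their minimum [u] will do. *)
Lemma elimination_solvable (A : finType) (c f : A -> F) :
  (forall i, 0 <= c i -> f i < 0) ->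
  (forall i j, 0 <= c i -> c j < 0 -> c i * f j - c j * f i < 0) ->
  exists2 t, 0 <= t & forall a, f a + t * c a < 0.
Proof.
move=> f_lt0 fc_lt0.
(* The default [l + 1] serves when nothing bounds [t] from above. *)
pose l := \big[Num.max/0]_(j | c j < 0) (f j / - c j).
pose u := \big[Num.min/l + 1]_(i | 0 < c i) (- f i / c i).
have l_ge0 : 0 <= l by apply: bigmax_ge_id.
have lt_lu : l < u.
  apply: lt_bigmin => [|i ci]; first by rewrite ltrDl.
  apply: bigmax_lt => [|j cj]; first by rewrite divr_gt0 // oppr_gt0 f_lt0 // ltW.
  rewrite ltr_pdivlMr // mulrAC ltr_pdivrMr ?oppr_gt0 //.
  by have := fc_lt0 _ _ (ltW ci) cj; lra.
exists ((l + u) / 2) => [|a]; first by lra.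
case: (ltgtP (c a) 0) => ca.
- have : f a / - c a <= l by apply: le_bigmax_cond.
  by rewrite ler_pdivrMr ?oppr_gt0 //; nra.
- have : u <= - f a / c a by apply: bigmin_le_cond.
  by rewrite ler_pdivlMr //; nra.
- by rewrite ca mulr0 addr0 f_lt0 // ca.
Qed.

(** Both alternatives are left homogeneous, the second one with a positive weight
    in place of a sum equal to 1, so that scaling is only done once, at the
    end. *)
Lemma alternative_seq (B : eqType) (r : seq B) (A : finType) (a0 : A)
    (g : A -> B -> F) : uniq r ->
  (exists2 q : B -> F, forall b, 0 <= q b &
     forall a, \sum_(b <- r) q b * g a b < 0) \/
  (exists p : A -> F, [/\ forall a, 0 <= p a, exists a, 0 < p a &
     forall b, b \in r -> 0 <= \sum_a p a * g a b]).
Proof.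
elim: r A a0 g => [|b0 r IH] A a0 g /=.
  by right; exists (fun=> 1); split=> //; exists a0; apply: ltr01.
case/andP=> b0r ur; pose c a := g a b0.
have [/existsP[i0 ci0]|/existsPn c_lt0] := boolP [exists a, 0 <= c a]; last first.
  left; exists (fun b => (b == b0)%:R) => [b|a]; first exact: ler0n.
  rewrite big_cons eqxx mul1r big_seq big1 ?addr0.
    by have := c_lt0 a; rewrite -ltNge.
  by move=> b br; case: eqVneq br => [->|_ _]; rewrite ?mul0r // (negPf b0r).
(* [comb h (i, j)] is the value at a new row of the function [h] on the old
   rows.  A row [i] with [c i < 0] is first replaced with [i0], and the new row
   is an old one when [c j >= 0]; so every pair defines a new row. *)
pose pos i := if 0 <= c i then i else i0.
have c_pos i : 0 <= c (pos i) by rewrite /pos; case: ifP.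
pose comb (h : A -> F) (k : A * A) :=
  if c k.2 < 0 then c (pos k.1) * h k.2 - c k.2 * h (pos k.1) else h (pos k.1).
have comb_ge0 h k : (forall a, 0 <= h a) -> 0 <= comb h k.
  move=> h0; rewrite /comb; case: ifP => // ck.
  by rewrite -mulNr addr_ge0 // mulr_ge0 // oppr_ge0 ltW.
have combE h k : comb h k = \sum_a comb (fun x => (x == a)%:R) k * h a.
  have E x : h x = \sum_a (x == a)%:R * h a.
    rewrite (bigD1 x) //= eqxx mul1r big1 ?addr0 // => a /negPf.
    by rewrite eq_sym => ->; rewrite mul0r.
  rewrite /comb; case: ifP => ck; last exact: E.
  rewrite [h k.2]E [h (pos _)]E !mulr_sumr -sumrB.
  by apply: eq_bigr => a _; rewrite mulrBl !mulrA.
have comb_sum (q : B -> F) k : \sum_(b <- r) q b * comb (g^~ b) k =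
    comb (fun a => \sum_(b <- r) q b * g a b) k.
  rewrite /comb; case: ifP => // ck; rewrite !mulr_sumr -sumrB.
  by apply: eq_bigr => b _; ring.
have [[q q0 qlt]|[p [p0 [k pk] pge]]] := IH _ (i0, i0) (fun k b => comb (g^~ b) k) ur.
  left; pose f a := \sum_(b <- r) q b * g a b.
  have [||t t0 ft] := @elimination_solvable A c f.
  - move=> i ci; have := qlt (i, i); rewrite comb_sum /comb /= /pos ci.
    by rewrite (le_gtF ci).
  - move=> i j ci cj; have := qlt (i, j); rewrite comb_sum /comb /= cj.
    by rewrite /pos ci.
  exists (fun b => if b == b0 then t else q b) => [b|a]; first by case: eqP.
  rewrite big_cons eqxx addrC; apply: le_lt_trans (ft a).
  rewrite lerD2r big_seq [f a]big_seq; apply: ler_sum => b br.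
  by case: eqVneq br => [->|//]; rewrite (negPf b0r).
pose w k a := comb (fun x => (x == a)%:R) k.
have w0 k' a : 0 <= w k' a by apply: comb_ge0 => x; apply: ler0n.
right; exists (fun a => \sum_k p k * w k a).
have sumE h : \sum_a (\sum_k p k * w k a) * h a = \sum_k p k * comb h k.
  under eq_bigr do rewrite mulr_suml.
  rewrite exchange_big; apply: eq_bigr => k' _; rewrite (combE h) mulr_sumr.
  by apply: eq_bigr => a _; rewrite mulrA.
split.
- by move=> a; apply: sumr_ge0 => k' _; apply: mulr_ge0.
- exists (pos k.1); rewrite (bigD1 k) //=; apply: ltr_wpDr.
    by apply: sumr_ge0 => k' _; apply: mulr_ge0.
  apply: mulr_gt0 => //; rewrite /w /comb eqxx; case: ifP => ck; last exact: ltr01.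
  by rewrite mulr1 ltr_wpDl ?oppr_gt0 // mulr_ge0 // ler0n.
- move=> b; rewrite inE => /orP[/eqP->|br]; rewrite sumE; last exact: pge.
  apply: sumr_ge0 => k' _; apply: mulr_ge0 => //; rewrite /comb.
  by case: ifP => _; [rewrite -/(c _) -/(c _) mulrC subrr | apply: c_pos].
Qed.

Lemma normalize (T : finType) (q : T -> F) :
  (forall t, 0 <= q t) -> (exists t, 0 < q t) ->
  exists2 s, 0 < s & \sum_t q t / s = 1.
Proof.
move=> q0 [t qt]; have s0 : 0 < \sum_t q t.
  by rewrite (bigD1 t) //= ltr_wpDr // sumr_ge0.
by exists (\sum_t q t) => //; rewrite -mulr_suml divff // gt_eqF.
Qed.

Lemma alternative (A B : finType) (a0 : A) (g : A -> B -> F) :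
  (exists q : B -> F, [/\ forall b, 0 <= q b, \sum_b q b = 1 &
     forall a, \sum_b q b * g a b < 0]) \/
  (exists p : A -> F, [/\ forall a, 0 <= p a, \sum_a p a = 1 &
     forall b, 0 <= \sum_a p a * g a b]).
Proof.
have [[q q0 qlt]|[p [p0 pt pge]]] := alternative_seq a0 g (index_enum_uniq B).
  have [|s s0 s1] := normalize q0.
    apply/existsP; apply: contraT => /existsPn nq.
    have := qlt a0; rewrite big1 ?ltxx // => b _.
    by have := nq b; rewrite lt_neqAle q0 andbT negbK => /eqP<-; rewrite mul0r.
  left; exists (fun b => q b / s); split=> // [b|a]; first by rewrite divr_ge0 // ltW.
  under eq_bigr do rewrite mulrAC.
  by rewrite -mulr_suml pmulr_llt0 // invr_gt0.
have [s s0 s1] := normalize p0 pt.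
right; exists (fun a => p a / s); split=> // [a|b]; first by rewrite divr_ge0 // ltW.
under eq_bigr do rewrite mulrAC.
by rewrite -mulr_suml pmulr_lge0 ?invr_gt0 //; apply: pge; apply: mem_index_enum.
Qed.

End Alternative.

(** * Coherent payoff functions *)

Lemma no_sum (T : finType) (f : T -> game) : (forall t, numeric (f t)) ->
  numeric (\big[gadd/gzero]_(t : T) f t) /\
  no (\big[gadd/gzero]_(t : T) f t) = (\sum_t no (f t))%R.
Proof.
move=> nf; elim/big_rec2: _ => [|t y z _ [nz <-]].
  by split; [apply: numeric0 | apply: no0].
by split; [apply: numeric_add | rewrite no_add].
Qed.

Lemma no_leP x y : numeric x -> numeric y -> gle x y <-> (no x <= no y)%R.
Proof. by move=> nx ny; rewrite no_leE //; split=> /cls_leP. Qed.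

Theorem theorem1 (A B : finType) (hA : (0 < #|A|)%N) (hB : (0 < #|B|)%N)
    (g : A -> B -> surreal) :
  coherent g ->
  exists p : A -> surreal,
    (forall a : A, 0 <= p a)%No /\
    (\sum_(a : A) p a === 1)%No /\
    (forall b : B, 0 <= \sum_(a : A) (p a * g a b))%No.
Proof.
move=> coh; have [a0 _] := card_gt0P hA.
have prob (T : finType) (q : T -> No) : (forall t, (0 <= q t)%R) -> (\sum_t q t = 1)%R ->
    prob_vector (fun t => no_form (q t)).
  move=> q0 q1; have nq t : numeric (no_form (q t)) by apply: formP.
  split=> [t|]; first by apply/(no_leP numeric0) => //; rewrite no_formK no0.
  have [n e] := no_sum nq; have n1 := numeric1.
  apply/cls_eq; rewrite -noE // -(noE n1).
  by rewrite e no1 -q1; congr noval; apply: eq_bigr => t _; rewrite no_formK.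
have noprod (T : finType) (q : T -> No) (h : T -> surreal) :
    numeric (\sum_(t : T) (no_form (q t) * h t))%No /\
    no (\sum_(t : T) (no_form (q t) * h t))%No = (\sum_t q t * no (h t))%R.
  have nf t : numeric (gmul (no_form (q t)) (h t)).
    by apply: numeric_mul; apply: formP.
  have [n ->] := no_sum nf; split=> //; apply: eq_bigr => t _.
  by rewrite noM ?no_formK //; apply: formP.
have [[q [q0 q1 qlt]]|[p [p0 p1 pge]]] := alternative a0 (fun a b => no (g a b)).
  case: coh; exists (fun b => no_form (q b)); split=> [|a]; first exact: prob.
  have [n e] := noprod _ q (g a).
  by apply/cls_ltP; rewrite -no_ltE ?e ?no0 //; apply: numeric0.
have [pr0 pr1] := prob _ p p0 p1.
exists (fun a => no_form (p a)); split=> //; split=> // b.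
have [n e] := noprod _ p (g^~ b).
by apply/(no_leP numeric0 n); rewrite e no0.
Qed.
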